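(* Let $T$ be a tree with $m$ edges, with bipartition classes $T_A$ and $T_B$, and let $G$ be a bipartite graph with bipartition classes $A$ and $B$ that admits a $T$-equitable colouring $\phi: E(G)\to E(T)$. If for every vertex $v\in V(G)$ and every colour $j\in E(T)$ we have $d_j(v)\ge 10^{50m}$ (i.e. the minimum degree in each colour is at least $10^{50m}$), then $G$ has a $T$-decomposition.
   Context: All graphs are finite and simple. A vertex $v\in V(G)$ and a vertex $t\in V(T)$ are compatible if $v\in A$ and $t\in T_A$, or $v\in B$ and $t\in T_B$. For an (improper) edge-colouring $\phi:E(G)\to E(T)$, $d_j(v)$ denotes the number of edges of colour $j$ incident with $v$, and $S(t)$ denotes the set of edges of $T$ incident with $t\in V(T)$. The colouring $\phi$ is $T$-equitable if for all compatible $v\in V(G)$, $t\in V(T)$ and all $j,k\in S(t)$ we have $d_j(v)=d_k(v)$. A $T$-decomposition of $G$ is a partition of $E(G)$ into parts each inducing a subgraph isomorphic to $T$. *)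

(* Defs.v *)
From mathcomp Require Import all_boot.
Set Implicit Arguments. Unset Strict Implicit. Unset Printing Implicit Defensive.

Definition simple_graph (V : finType) (G : rel V) : Prop :=
  symmetric G /\ irreflexive G.

Definition edges (V : finType) (G : rel V) : {set {set V}} :=
  [set e : {set V} | [exists x, exists y, G x y && (e == [set x; y])]].

Definition bipartition (V : finType) (G : rel V) (A B : {set V}) : Prop :=
  [/\ [disjoint A & B], A :|: B = [set: V] &
      forall x y, G x y -> (x \in A) && (y \in B) || (x \in B) && (y \in A)].

Definition acyclic (V : finType) (G : rel V) : Prop :=
  forall c : seq V, ucycle G c -> size c <= 2.

Definition is_tree (V : finType) (G : rel V) : Prop :=
  [/\ 0 < #|V|, (forall x y, connect G x y) & acyclic G].

Definition compatible (V U : finType) (A B : {set V}) (TA TB : {set U})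
  (v : V) (t : U) : bool :=
  (v \in A) && (t \in TA) || (v \in B) && (t \in TB).

Definition edge_colouring (V U : finType) (G : rel V) (T : rel U)
  (phi : {set V} -> {set U}) : Prop :=
  forall e, e \in edges G -> phi e \in edges T.

Definition deg_col (V U : finType) (G : rel V) (phi : {set V} -> {set U})
  (j : {set U}) (v : V) : nat :=
  #|[set e in edges G | (v \in e) && (phi e == j)]|.

Definition S_edges (U : finType) (T : rel U) (t : U) : {set {set U}} :=
  [set j in edges T | t \in j].

Definition T_equitable (V U : finType) (G : rel V) (T : rel U)
  (A B : {set V}) (TA TB : {set U}) (phi : {set V} -> {set U}) : Prop :=
  forall v t, compatible A B TA TB v t ->
    forall j k, j \in S_edges T t -> k \in S_edges T t ->
      deg_col G phi j v = deg_col G phi k v.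

(* An edge set P of G induces a subgraph isomorphic to T: there is an injective
   vertex map f : V(T) -> V(G) whose image of E(T) is exactly P (then the
   vertices covered by P are f(V(T)), as T is connected with >= 1 edge, or P
   is empty). *)
Definition iso_to_tree (V U : finType) (T : rel U) (P : {set {set V}}) : Prop :=
  exists f : U -> V, injective f /\
    P = [set [set f x; f y] | x in U, y in U & T x y].

Definition T_decomposition (V U : finType) (G : rel V) (T : rel U)
  (D : {set {set {set V}}}) : Prop :=
  partition D (edges G) /\ forall P, P \in D -> iso_to_tree T P.

(* Main.v *)
Require Import Defs.
From mathcomp Require Import all_boot perm zify.
Set Implicit Arguments. Unset Strict Implicit. Unset Printing Implicit Defensive.

(** Grow T one vertex at a time, keeping a decomposition of the edges coloured so
    far into injective copies of the current subtree.  For every t, the edges at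
    each vertex v of G compatible with t are first cut into blocks with between D
    and 2D edges of each colour at t, where D = 10^(50m).  A leaf t' attached at t
    is added by matching, inside each block, the copies whose t lies there with the
    edges of colour tt'.  If few copies of a block pass through any given vertex,
    the allowed pairs contain D/4 pairwise disjoint perfect matchings.  Pick one of
    them in each block: a vertex x lies on s' copies of a block only if s' picks, in
    distinct blocks, are all unlucky, and since block sizes are bounded each pick
    matters for boundedly many such events.  Rosenfeld's counting argument then
    provides picks without bad events, at the price of replacing the bound s on
    the number of copies through a block and a vertex by s' = 128 s. *)

(** * Disjoint perfect matchings in dense bipartite graphs *)

(** A permutation with fewest bad points has none: if [x] is bad, at most [2a < #|X|] points are
    excluded, and exchanging the images of [x] and a remaining [x1] makes both good. *)
Lemma dense_perm (X : finType) (r : rel X) (a : nat) :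
  (forall x, #|[set y | ~~ r x y]| <= a) ->
  (forall y, #|[set x | ~~ r x y]| <= a) ->
  a.*2 < #|X| -> exists s : {perm X}, forall x, r x (s x).
Proof.
move=> hx hy ha.
pose bad (s : {perm X}) := #|[set x | ~~ r x (s x)]|.
have [s _ smin] := arg_minnP bad (erefl : xpredT (1%g : {perm X})).
exists s => x; apply: contraT => badx.
have [x1 /andP[rxx1 rx1x]] : exists x1, r x (s x1) && r x1 (s x).
  apply/existsP; apply: contraLR ha; rewrite negb_exists -leqNgt => /forallP no.
  have cov : [set: X] \subset
      s @^-1: [set y | ~~ r x y] :|: [set x1 | ~~ r x1 (s x)].
    by apply/subsetP => y _; rewrite !inE -negb_and.
  have := subset_leq_card cov; rewrite cardsT => /leq_trans; apply.
  apply: (leq_trans (leq_card_setU _ _)); rewrite -addnn leq_add //.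
  have -> : s @^-1: [set y | ~~ r x y] = [set (s^-1)%g y | y in [set y | ~~ r x y]].
    apply/setP => y; rewrite !inE; apply/idP/imsetP => [h | [z]].
      by exists (s y); rewrite ?inE // permK.
    by rewrite inE => h ->; rewrite permKV.
  by apply: leq_trans (leq_imset_card _ _) _.
have nx : x1 != x by apply: contraNneq badx => e; move: rxx1; rewrite e.
pose s' := (tperm x x1 * s)%g.
suff : bad s' < bad s by rewrite ltnNge smin.
apply: proper_card; apply/properP; split.
  apply/subsetP => y; rewrite !inE permM; case: tpermP => [->|->|//].
    by rewrite rxx1.
  by rewrite rx1x.
by exists x; rewrite !inE // permM tpermL negbK.
Qed.

(** Greedy: [K] permutations already chosen cost every point at most [K] further partners, so
    [dense_perm] still applies with [a + K]. *)
Lemma disjoint_perms (X : finType) (r : rel X) (a K : nat) :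
  (forall x, #|[set y | ~~ r x y]| <= a) ->
  (forall y, #|[set x | ~~ r x y]| <= a) ->
  (a + K).*2 <= #|X| ->
  exists s : nat -> {perm X},
    (forall k x, k < K -> r x (s k x)) /\
    (forall k l x, k < K -> l < K -> s k x = s l x -> k = l).
Proof.
move=> hx hy; elim: K => [|K IH] hK; first by exists (fun=> 1%g).
have {}[|s [sr sd]] := IH; first by apply: leq_trans hK; lia.
pose r' x y := r x y && [forall k : 'I_K, s k x != y].
have [||| s1 s1r] := @dense_perm X r' (a + K).
- move=> x; have sub : [set y | ~~ r' x y] \subset
      [set y | ~~ r x y] :|: [set s k x | k : 'I_K].
    apply/subsetP => y; rewrite !inE negb_and; case/orP => [->//|].
    rewrite negb_forall => /existsP[k]; rewrite negbK => /eqP <-.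
    by apply/orP; right; apply: imset_f.
  apply: leq_trans (subset_leq_card sub) _.
  apply: leq_trans (leq_card_setU _ _) _; rewrite leq_add //.
  by apply: leq_trans (leq_imset_card _ _) _; rewrite card_ord.
- move=> y; have sub : [set x | ~~ r' x y] \subset
      [set x | ~~ r x y] :|: [set (s k)^-1%g y | k : 'I_K].
    apply/subsetP => x; rewrite !inE negb_and; case/orP => [->//|].
    rewrite negb_forall => /existsP[k]; rewrite negbK => /eqP <-.
    by apply/orP; right; apply/imsetP; exists k; rewrite ?permK.
  apply: leq_trans (subset_leq_card sub) _.
  apply: leq_trans (leq_card_setU _ _) _; rewrite leq_add //.
  by apply: leq_trans (leq_imset_card _ _) _; rewrite card_ord.
- by apply: leq_trans hK; lia.
have s1d x k : k < K -> s k x != s1 x.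
  by move=> lt; have /andP[_ /forallP/(_ (Ordinal lt))] := s1r x.
exists (fun k => if k == K then s1 else s k); split=> [k x|k l x].
  case: eqVneq => [_ _|ne lt]; first by case/andP: (s1r x).
  by apply: sr; lia.
case: eqVneq => [->|nk]; case: eqVneq => [->//|nl] hk hl eqs.
- by have /eqP := @s1d x l ltac:(lia); rewrite eqs.
- by have /eqP := @s1d x k ltac:(lia); rewrite eqs.
- by apply: sd eqs; lia.
Qed.

Lemma disjoint_bijections (X Y : finType) (A : {set X}) (B : {set Y})
    (r : X -> Y -> bool) (a K : nat) :
  #|A| = #|B| -> Y ->
  (forall x, x \in A -> #|[set y in B | ~~ r x y]| <= a) ->
  (forall y, y \in B -> #|[set x in A | ~~ r x y]| <= a) ->
  #|A| = 0 \/ (a + K).*2 <= #|A| ->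
  exists f : 'I_K -> X -> Y,
    [/\ forall k x, x \in A -> f k x \in B /\ r x (f k x),
        forall k, {in A &, injective (f k)} &
        forall x, x \in A -> injective (f^~ x)].
Proof.
move=> eAB y0 hx hy [A0|hK].
  have {}A0 x : x \in A = false by rewrite (cards0_eq A0) inE.
  by exists (fun _ _ => y0); split=> [k x|k x y|x]; rewrite A0.
pose r' (i j : 'I_#|A|) := r (enum_val i) (enum_val (cast_ord eAB j)).
have [|||s [sr sd]] := @disjoint_perms _ r' a K.
- move=> i; apply: leq_trans (hx _ (enum_valP i)).
  rewrite -(card_imset _ (inj_comp enum_val_inj (@cast_ord_inj _ _ eAB))).
  apply: subset_leq_card; apply/subsetP => _ /imsetP[j hj ->].
  by move: hj; rewrite !inE enum_valP.
- move=> j; apply: leq_trans (hy _ (enum_valP (cast_ord eAB j))).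
  rewrite -(card_imset _ enum_val_inj).
  apply: subset_leq_card; apply/subsetP => _ /imsetP[i hi ->].
  by move: hi; rewrite !inE enum_valP.
- by rewrite card_ord.
(* [A] may still be empty when [a] and [K] are 0, while [enum_rank_in] needs a point. *)
case: (posnP #|A|) => [A0|Apos].
  have {}A0 x : x \in A = false by rewrite (cards0_eq A0) inE.
  by exists (fun _ _ => y0); split=> [k x|k x y|x]; rewrite A0.
have [x0 x0A] : exists x0, x0 \in A by apply/card_gt0P.
pose f (k : 'I_K) x := enum_val (cast_ord eAB (s k (enum_rank_in x0A x))).
exists f; split=> [k x xA|k x y xA yA|x xA k l].
- split; first exact: enum_valP.
  by have := sr k (enum_rank_in x0A x) (ltn_ord k); rewrite /r' enum_rankK_in.
- move/enum_val_inj/cast_ord_inj/perm_inj => e.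
  by rewrite -(enum_rankK_in x0A xA) e enum_rankK_in.
- by move/enum_val_inj/cast_ord_inj/sd => e; apply/val_inj/e.
Qed.

(** * Sparse choice functions *)

Section Choice.
Variables (P : finType) (K s : nat).
Implicit Types (c : {ffun P -> 'I_K}) (Y : {set P * 'I_K}) (S : {set P}).

Definition upd c p b : {ffun P -> 'I_K} := [ffun q => if q == p then b else c q].

(** Updating at [p] maps each fibre over a value injectively into any other, so the value at [p] is
    uniform and independent of [Pr]. *)
Lemma card_fixed_value (Pr : pred {ffun P -> 'I_K}) p a :
  (forall c b, Pr (upd c p b) = Pr c) ->
  K * #|[set c | Pr c & c p == a]| = #|[set c | Pr c]|.
Proof.
move=> inv; pose E b := [set c | Pr c & c p == b].
have card_E b : #|E b| = #|E a|.
  have le b1 b2 : #|E b1| <= #|E b2|.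
    have injU : {in E b1 &, injective (fun c => upd c p b2)}.
      move=> c c'; rewrite !inE => /andP[_ /eqP h] /andP[_ /eqP h'] e.
      apply/ffunP => q; have := congr1 (fun g : {ffun P -> 'I_K} => g q) e.
      by rewrite !ffunE; case: eqP => [->|//]; rewrite h h'.
    rewrite -(card_in_imset injU); apply: subset_leq_card.
    apply/subsetP => _ /imsetP[c + ->]; rewrite !inE inv ffunE eqxx => /andP[-> _] /=.
    by rewrite eqxx.
  by apply/eqP; rewrite eqn_leq !le.
have -> : #|[set c | Pr c]| = \sum_(b < K) #|E b|.
  rewrite -sum1_card (partition_big (fun c => c p) predT) //=.
  by apply: eq_bigr => b _; rewrite -sum1_card; apply: eq_bigl => c; rewrite !inE.
by rewrite (eq_bigr (fun=> #|E a|)) // sum_nat_const card_ord.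
Qed.

Definition contains c Y := [forall y in Y, c y.1 == y.2].

(** [Y] is a partial function, as [fst] is injective on it, and [Pr] ignores its domain; fixing one
    coordinate after another divides the count by [K] each time. *)
Lemma card_contains (Pr : pred {ffun P -> 'I_K}) Y :
  {in Y &, injective (@fst P 'I_K)} ->
  (forall c p b, p \in [set y.1 | y in Y] -> Pr (upd c p b) = Pr c) ->
  K ^ #|Y| * #|[set c | Pr c & contains c Y]| = #|[set c | Pr c]|.
Proof.
move en : #|Y| => n; elim: n Y en Pr => [|n IH] Y en Pr inj inv.
  rewrite mul1n; apply: eq_card => c; rewrite !inE.
  rewrite (cards0_eq en) (_ : contains c set0) ?andbT //.
  by apply/forall_inP => y; rewrite inE.
have [y yY] : exists y, y \in Y by apply/card_gt0P; rewrite en.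
have nY : #|Y :\ y| = n by move: (cardsD1 y Y); rewrite yY en; lia.
have yN : y.1 \notin [set z.1 | z in Y :\ y].
  apply/negP => /imsetP[z]; rewrite 2!inE => /andP[/eqP nz zY] e.
  by apply: nz; apply: inj.
rewrite -(@card_fixed_value Pr y.1 y.2); last by move=> c b; apply: inv; apply: imset_f.
rewrite -(IH _ nY (fun c => Pr c && (c y.1 == y.2))).
- rewrite expnS -mulnA; congr (_ * (_ * _)); apply: eq_card => c; rewrite !inE -andbA.
  congr (_ && _); apply/forall_inP/andP => [h | [h /forall_inP h'] z zY].
    split; first exact: h.
    by apply/forall_inP => z; rewrite 2!inE => /andP[_]; apply: h.
  by have [->//|nz] := eqVneq z y; apply: h'; rewrite !inE nz.
- by move=> u v; rewrite !inE => /andP[_ uY] /andP[_ vY]; apply: inj.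
- move=> c p b pY; rewrite ffunE inv.
    by rewrite ifN //; apply: contraNneq yN => ->.
  by case/imsetP: pY => z; rewrite 2!inE => /andP[_ zY] ->; apply: imset_f.
Qed.

Variables (Fb : {set {set P * 'I_K}}) (N : nat).
Hypothesis card_Fb : forall Y, Y \in Fb -> #|Y| = s.
Hypothesis inj_Fb : forall Y, Y \in Fb -> {in Y &, injective (@fst P 'I_K)}.
Hypothesis deg_Fb : forall p, #|[set Y in Fb | p \in [set y.1 | y in Y]]| <= N.
Hypothesis small_N : N * 2 ^ s <= K ^ s.
Hypothesis K_gt0 : 0 < K.
Hypothesis s_gt0 : 0 < s.

Let dom Y := [set y.1 | y in Y].
(** Only constraints with domain inside [S] are imposed, but the functions remain total, so these
    sets can be compared by size for different [S]. *)
Definition good S := [set c | [forall Y in Fb, (dom Y \subset S) ==> ~~ contains c Y]].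

Lemma good_sub S1 S2 : S1 \subset S2 -> good S2 \subset good S1.
Proof.
move=> sub; apply/subsetP => c; rewrite !inE => /forall_inP h.
apply/forall_inP => Y YF; apply/implyP => dS; apply: (implyP (h Y YF)).
exact: subset_trans sub.
Qed.

Lemma good_upd S c p b : p \notin S -> (upd c p b \in good S) = (c \in good S).
Proof.
move=> pS; rewrite !inE; apply: eq_forallb => Y; congr (_ ==> _).
case: (boolP (dom Y \subset S)) => //= dS; congr (~~ _).
apply: eq_forallb => y; case: (boolP (y \in Y)) => //= yY; rewrite ffunE.
rewrite ifN //; apply: contraNneq pS => <-; apply: (subsetP dS); exact: imset_f.
Qed.

(* Rosenfeld's counting argument: adding one vertex to the set on which the
   constraints are imposed loses at most half of the good functions. *)
Lemma good_half S : forall p, p \notin S -> #|good S| <= 2 * #|good (p |: S)|.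
Proof.
move en : #|S| => n; elim/ltn_ind: n S en => n IH S en p pS.
(* By induction, restoring the points of [D] one at a time costs a factor 2 each. *)
have many (D : {set P}) : D \subset S -> #|good (S :\: D)| <= 2 ^ #|D| * #|good S|.
  move ek : #|D| => k; elim: k D ek => [|k IHk] D ek DS.
    by rewrite (cards0_eq ek) setD0 mul1n.
  have [d dD] : exists d, d \in D by apply/card_gt0P; rewrite ek.
  have kD : #|D :\ d| = k by move: (cardsD1 d D); rewrite dD ek; lia.
  have dS : d \in S := subsetP DS d dD.
  have lt : #|S :\: D| < n.
    by rewrite -en; apply: proper_card; apply/properP; split;
      [exact: subsetDl | exists d; rewrite // !inE dD].
  have dN : d \notin S :\: D by rewrite !inE dD.
  apply: (leq_trans (IH _ lt _ erefl _ dN)).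
  have -> : d |: (S :\: D) = S :\: (D :\ d).
    apply/setP => z; rewrite !inE; have [->|//] := eqVneq z d.
    by rewrite dS.
  rewrite expnS -mulnA leq_mul2l /=; apply: IHk => //.
  exact: subset_trans (subsetDl _ _) DS.
(* A function lost on adding [p] contains some [Y] of [F] and satisfies the constraints inside
   [S :\: dom Y], which do not see its values on [dom Y]. *)
pose F := [set Y in Fb | (p \in dom Y) && (dom Y \subset p |: S)].
have cov : good S \subset good (p |: S) :|:
    \bigcup_(Y in F) [set c | c \in good (S :\: dom Y) & contains c Y].
  apply/subsetP => c cS; rewrite in_setU; case: (boolP (c \in good (p |: S))) => //= cN.
  move: cN; rewrite inE => /forall_inPn[Y YF].
  rewrite negb_imply negbK => /andP[dY cY].
  have pY : p \in dom Y.
    apply: contraTT cY => pY; move: (cS); rewrite inE => /forall_inP/(_ Y YF)/implyP h; apply: h.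
    apply/subsetP => z zY; have := subsetP dY z zY; rewrite in_setU1.
    by case/orP => // /eqP e; rewrite -e zY in pY.
  apply/bigcupP; exists Y; first by rewrite inE YF pY dY.
  by rewrite inE cY andbT; apply: (subsetP (good_sub (subsetDl S (dom Y)))).
(* As [p] is not in [S], only [s - 1] points of [dom Y] have to be restored; this pays for the
   factor 2 on the left. *)
have bound Y : Y \in F -> K ^ s * (2 * #|[set c | c \in good (S :\: dom Y) & contains c Y]|)
    <= 2 ^ s * #|good S|.
  rewrite inE => /and3P[YF pY dY].
  rewrite mulnCA -{1}(card_Fb YF) (card_contains (inj_Fb YF)); last first.
    by move=> c q b qY; apply: good_upd; rewrite !inE qY.
  have -> : S :\: dom Y = S :\: (dom Y :\ p).
    by apply/setP => z; rewrite !inE; case: eqVneq => // ->; rewrite (negbTE pS) !andbF.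
  have sd : s = #|dom Y :\ p|.+1.
    by rewrite -(card_Fb YF) -(card_in_imset (inj_Fb YF)) (cardsD1 p) pY.
  rewrite {1}sd expnS -mulnA leq_mul2l /= cardsE.
  have le := many (dom Y :\ p).
  apply: le; apply/subsetP => z; rewrite !inE => /andP[nz zY].
  by have := subsetP dY z zY; rewrite in_setU1 (negbTE nz).
have cF : #|F| <= N.
  apply: leq_trans (deg_Fb p); apply: subset_leq_card; apply/subsetP => Y.
  by rewrite !inE => /and3P[-> -> _].
have lebig : 2 * #|\bigcup_(Y in F) [set c | c \in good (S :\: dom Y) & contains c Y]|
    <= #|good S|.
  rewrite -(@leq_pmul2l (K ^ s)) ?expn_gt0 ?K_gt0 //.
  apply: (@leq_trans (K ^ s * (2 * \sum_(Y in F)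
      #|[set c | c \in good (S :\: dom Y) & contains c Y]|))).
    rewrite !leq_mul2l; apply/orP; right; apply/orP; right.
    elim/big_rec2: _ => [|Y m1 m2 _ le]; first by rewrite cards0.
    by apply: leq_trans (leq_card_setU _ _) _; rewrite leq_add2l.
  rewrite !big_distrr /=; apply: (@leq_trans (\sum_(Y in F) 2 ^ s * #|good S|)).
    exact: leq_sum.
  rewrite sum_nat_const mulnA leq_mul2r; apply/orP; right.
  by apply: leq_trans small_N; rewrite leq_mul2r cF orbT.
move: lebig (leq_trans (subset_leq_card cov) (leq_card_setU _ _)).
by move: #|good S| #|good (p |: S)| #|\bigcup_(Y in F) _|; lia.
Qed.

Lemma good_exists : exists c, forall Y, Y \in Fb -> ~~ contains c Y.
Proof.
suff pos S : 0 < #|good S|.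
  have /card_gt0P[c] := pos setT; rewrite inE => /forall_inP h.
  by exists c => Y YF; apply: (implyP (h Y YF)); apply: subsetT.
move en : #|S| => n; elim: n S en => [|n IH] S en.
  apply/card_gt0P; exists [ffun=> Ordinal K_gt0]; rewrite inE.
  apply/forall_inP => Y YF; apply/implyP => dY.
  have := subset_leq_card dY; rewrite en leqn0 (card_in_imset (inj_Fb YF)) card_Fb //.
  by rewrite eqn0Ngt s_gt0.
have [p pS] : exists p, p \in S by apply/card_gt0P; rewrite en.
have nS : #|S :\ p| = n by move: (cardsD1 p S); rewrite pS en; lia.
have pN : p \notin S :\ p by rewrite !inE eqxx.
by have := good_half pN; rewrite setD1K //; have := IH _ nS; lia.
Qed.

End Choice.

(** [Z k] lists the picks unlucky for the event [k]. The [s]-subsets of the [Z k] are forbidden; a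
    point meets at most [L] events, hence at most [L * 'C(M, s)] of these subsets. *)
Lemma sparse_choice (P Key : finType) (K s L M : nat) (Z : Key -> {set P * 'I_K}) :
  (forall k, #|Z k| <= M) ->
  (forall p, #|[set k | [exists a, (p, a) \in Z k]]| <= L) ->
  L * 'C(M, s) * 2 ^ s <= K ^ s -> 0 < K -> 0 < s ->
  exists c : P -> 'I_K, forall k, #|[set p | (p, c p) \in Z k]| < s.
Proof.
move=> hM hL small K_gt0 s_gt0.
(* Subsets giving two values to one point are dropped: no choice function contains them. *)
pose inj1 (Y : {set P * 'I_K}) := #|[set y.1 | y in Y]| == #|Y|.
pose FbK k := [set Y : {set P * 'I_K} | Y \subset Z k & #|Y| == s].
pose Fb := [set Y in \bigcup_k FbK k | inj1 Y].
have [|||c hc] := @good_exists P K s Fb (L * 'C(M, s)) _ _ _ small K_gt0 s_gt0.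
- by move=> Y; rewrite inE => /andP[/bigcupP[k _]]; rewrite inE => /andP[_ /eqP].
- by move=> Y; rewrite inE => /andP[_ /imset_injP].
- move=> p; apply: (@leq_trans (\sum_(k in [set k | [exists a, (p, a) \in Z k]]) #|FbK k|)).
    apply: (@leq_trans #|\bigcup_(k in [set k | [exists a, (p, a) \in Z k]]) FbK k|).
      apply: subset_leq_card; apply/subsetP => Y; rewrite !inE.
      case/andP => /andP[/bigcupP[k _ Yk] _] /imsetP[[q a] yY /= ->].
      apply/bigcupP; exists k => //; rewrite inE; apply/existsP; exists a.
      by move: Yk; rewrite inE => /andP[/subsetP sub _]; apply: sub.
    elim/big_rec2: _ => [|Y m1 m2 _ le]; first by rewrite cards0.
    by apply: leq_trans (leq_card_setU _ _) _; rewrite leq_add2l.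
  apply: leq_trans (leq_mul (hL p) (leqnn _)); rewrite -sum_nat_const.
  by apply: leq_sum => k _; rewrite cards_draws leq_bin2l.
exists c => k; rewrite ltnNge; apply/negP => le.
have [X XZ cX] : exists2 X : {set P}, X \subset [set p | (p, c p) \in Z k] & #|X| = s.
  have : 0 < #|[set X : {set P} | X \subset [set p | (p, c p) \in Z k] & #|X| == s]|.
    by rewrite cards_draws bin_gt0.
  by case/card_gt0P => X; rewrite inE => /andP[h /eqP]; exists X.
have inj2 : injective (fun p => (p, c p)) by move=> p q [].
pose Y := [set (p, c p) | p in X].
have YF : Y \in Fb.
  rewrite inE /inj1 (card_imset _ inj2) -imset_comp (eq_imset (g := id)) //.
  rewrite imset_id eqxx andbT; apply/bigcupP; exists k => //.
  rewrite inE (card_imset _ inj2) cX eqxx andbT; apply/subsetP => _ /imsetP[p pX ->].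
  by have := subsetP XZ p pX; rewrite inE.
by apply: (negP (hc Y YF)); apply/forall_inP => _ /imsetP[p _ ->].
Qed.

(** * Counting bounds *)

Lemma expnS_le_double n j : j.*2 <= n.+1 -> n.+1 ^ j <= 2 * n ^ j.
Proof.
(* Bernoulli's inequality for (1 - 1/(n+1))^i *)
have bern i : i <= n.+1 -> n.+1 ^ i * (n.+1 - i) <= n ^ i * n.+1.
  elim: i => [|i IH] le; first by rewrite !mul1n subn0.
  apply: (@leq_trans (n * (n.+1 ^ i * (n.+1 - i)))).
    by rewrite expnS [n.+1 * _]mulnC mulnCA -!mulnA leq_mul2l; nia.
  by rewrite expnS -[n * _ * _]mulnA leq_mul2l IH ?orbT // ltnW.
move=> le; have := bern j ltac:(lia); nia.
Qed.

(** A crude Stirling bound: (1 + 1/n)^n is at most 4, each half of the exponent contributing at most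
    2. *)
Lemma expnn_le_fact n : n ^ n <= 4 ^ n * n`!.
Proof.
elim: n => // n IH; rewrite expnS factS [4 ^ _]expnS.
suff : n.+1 ^ n <= 4 * n ^ n by nia.
have e : n./2 + uphalf n = n by rewrite uphalf_half addnCA addnn odd_double_half.
rewrite -{2 4}e !expnD; apply: (@leq_trans (2 * n ^ n./2 * (2 * n ^ uphalf n))).
  by apply: leq_mul; apply: expnS_le_double; lia.
by rewrite mulnACA.
Qed.

(** Blocks of size [D] are peeled off until at most [2D] points remain. Labels stay below [d], so
    they fit in a finite type fixed in advance. *)
Lemma blocks (D d : nat) : 0 < D -> D <= d -> exists h : nat -> nat,
  (forall a, a < d -> h a < d) /\
  forall r, let c := count (fun a => h a == r) (iota 0 d) in
    c = 0 \/ D <= c <= D.*2.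
Proof.
move=> Dpos; elim/ltn_ind: d => d IH le; case: (leqP d D.*2) => [le2|lt2].
  exists (fun=> 0); split=> [a|r /=]; first lia.
  by case: r => [|r]; rewrite ?count_predT ?size_iota ?count_pred0;
    [right; rewrite le | left].
have [h [hlt hc]] := IH (d - D) ltac:(lia) ltac:(lia).
(* The last [D] points get the label [d - D], which [h] does not take on the points below. *)
exists (fun a => if a < d - D then h a else d - D); split=> [a ad|r /=].
  by case: ifP => [/hlt|]; lia.
have -> : iota 0 d = iota 0 (d - D) ++ iota (d - D) D by rewrite -iotaD; congr iota; lia.
rewrite count_cat.
have -> : count (fun a => (if a < d - D then h a else d - D) == r) (iota (d - D) D)
    = (d - D == r) * D.
  rewrite (@eq_in_count _ _ (fun=> d - D == r)).
    by case: (d - D == r); rewrite ?count_predT ?size_iota ?mul1n ?count_pred0.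
  by move=> a; rewrite mem_iota => /andP[ge _]; rewrite ltnNge ge.
have -> : count (fun a => (if a < d - D then h a else d - D) == r) (iota 0 (d - D))
    = count (fun a => h a == r) (iota 0 (d - D)).
  by apply: eq_in_count => a; rewrite mem_iota add0n => /= ->.
case: eqVneq => [<-|_]; last by rewrite mul0n addn0; apply: hc.
rewrite (_ : count _ _ = 0); first by right; lia.
apply/eqP; rewrite -leqn0 leqNgt -has_count; apply/hasPn => a.
by rewrite mem_iota => /= /hlt; lia.
Qed.

Lemma map_index_iota (T : eqType) (s : seq T) :
  uniq s -> [seq index x s | x <- s] = iota 0 (size s).
Proof.
case: s => // x0 s us; apply: (@eq_from_nth _ 0); rewrite size_map ?size_iota // => i lt.
by rewrite (nth_map x0) // index_uniq // nth_iota.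
Qed.

Lemma card_block (V : finType) (X : {set V}) (h : pred nat) :
  #|[set w in X | h (index w (enum X))]| = count h (iota 0 #|X|).
Proof.
rewrite (cardE X) -(map_index_iota (enum_uniq X)) count_map.
rewrite cardE -size_filter; apply: perm_size.
apply: uniq_perm => [||w]; rewrite ?(filter_uniq _ (enum_uniq X)) ?enum_uniq //.
by rewrite mem_filter !mem_enum inE andbC.
Qed.

Lemma ffact_le_exp n k : n ^_ k <= n ^ k.
Proof.
elim: k => // k IH; rewrite ffactnSr expnSr; apply: leq_mul => //; exact: leq_subr.
Qed.

Lemma leq_exp2n n : n <= 2 ^ n. Proof. exact/ltnW/ltn_expl. Qed.

(** [4 * m * 128 ^ n] is the bound [s] kept for a subtree on [n] vertices; with [D = 4K] the claim
    amounts to [n * s <= K]. *)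
Lemma room_for_matchings m n K : 0 < m -> n <= m -> 10 ^ (50 * m) = 4 * K ->
  (n * (4 * m * 128 ^ n) + K).*2 <= 10 ^ (50 * m).
Proof.
move=> m0 nm eK.
have h1 : 128 ^ n <= 128 ^ m by rewrite leq_exp2l.
have h2 := leq_exp2n m.
have h16 : 16 <= 16 ^ m by apply: (@leq_pexp2l 16 1 m).
(* 16 is absorbed by [16 ^ m], and 16 * 2 * 2 * 128 = 8192 is below [10 ^ 4]. *)
have h3 : 16 * (2 ^ m * 2 ^ m * 128 ^ m) <= 10 ^ (50 * m).
  apply: (@leq_trans ((10 ^ 4) ^ m)); last by rewrite -expnM leq_exp2l // leq_mul2r orbT.
  rewrite -!expnMn; apply: leq_trans (leq_mul h16 (leqnn _)) _.
  by rewrite -expnMn leq_exp2r.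
have h4 : n * (4 * m * 128 ^ n) <= 2 ^ m * (4 * 2 ^ m * 128 ^ m).
  by rewrite !leq_mul // (leq_trans nm).
rewrite eK in h3 *; move: h3 h4; lia.
Qed.

(** Source of the factor 128: the binomial is at most (2Ds)^s' / s'! and s'! is at least (s'/4)^s';
    with [D = 4K] and two factors [2 ^ s'], one needs 2 * 2 * 4 * 8 * s <= s'. *)
Lemma few_forbidden m n K D s s' : 0 < m -> n <= m -> D = 4 * K -> D = 10 ^ (50 * m) ->
  4 * m <= s -> s' = 128 * s ->
  8 * n * D ^ 2 * 'C(D.*2 * s, s') * 2 ^ s' <= K ^ s'.
Proof.
move=> m0 nm eK eD ms es.
have hL : 8 * n * D ^ 2 <= 2 ^ s'.
  (* The exponent collects 8 = 2^3, n <= 2^m and D^2 with 10 <= 2^4; it is below [s'], which is at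
     least 512m. *)
  apply: (@leq_trans (2 ^ (3 + m + 4 * (50 * m) * 2))); last by rewrite leq_exp2l //; lia.
  rewrite !expnD eD; apply: leq_mul; first by rewrite leq_mul // (leq_trans nm) ?leq_exp2n.
  by rewrite (expnM 2 (4 * _)) leq_exp2r // (expnM 2 4) leq_exp2r //; lia.
rewrite -(@leq_pmul2r (4 ^ s' * s'`!)) ?muln_gt0 ?expn_gt0 ?fact_gt0 //.
apply: (@leq_trans (K ^ s' * s' ^ s')); last first.
  by rewrite leq_mul2l expnn_le_fact orbT.
rewrite -mulnA -[2 ^ s' * _]mulnCA mulnA.
have hC : 'C(D.*2 * s, s') * s'`! <= (D.*2 * s) ^ s'.
  by rewrite bin_ffact ffact_le_exp.
apply: (@leq_trans (2 ^ s' * 4 ^ s' * 2 ^ s' * (D.*2 * s) ^ s')).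
  have := leq_mul hL hC; set x := 2 ^ s'; set y := 4 ^ s'; nia.
rewrite -!expnMn {1}es; apply: eq_leq; congr (_ ^ _); lia.
Qed.

(** * Growing a tree *)

Section TreeGrowth.
Variables (U : finType) (T : rel U).
Hypotheses (T_simple : simple_graph T) (T_tree : is_tree T).

Definition connected_in (S : {set U}) :=
  forall x y, x \in S -> y \in S ->
    connect [rel x y | [&& T x y, x \in S & y \in S]] x y.

Definition inner_edges (S : {set U}) := [set j in edges T | j \subset S].

Lemma edgesP x y : T x y -> [set x; y] \in edges T.
Proof.
by move=> xy; rewrite inE; apply/existsP; exists x; apply/existsP; exists y; rewrite xy eqxx.
Qed.

Lemma tree_grow (S : {set U}) : connected_in S -> S != set0 -> S != setT ->
  exists t t', [/\ t \in S, t' \notin S, T t t',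
    forall t2, t2 \in S -> T t2 t' -> t2 = t & connected_in (t' |: S)].
Proof.
have [Tsym Tirr] := T_simple; have [_ Tconn Tac] := T_tree.
move=> spS /set0Pn[x xS] ST.
have [y yS] : exists y, y \notin S.
  apply/existsP; rewrite -negb_forall; apply: contra ST => /forallP h.
  by apply/eqP/setP => z; rewrite inE; apply: negbNE; apply: contraTN (h z) => ->.
have [t [t' [tS t'S tt']]] : exists t t', [/\ t \in S, t' \notin S & T t t'].
  have /connectP[p + ey] := Tconn x y.
  elim: p x xS ey => [|z p IH] x xS /= ey; first by rewrite ey xS in yS.
  case/andP => xz pz; case: (boolP (z \in S)) => zS; first exact: (IH z).
  by exists x, z.
exists t, t'; split=> // [t2 t2S t2t'|].
  apply/eqP; apply: contraT => ne.
  have /connectP[p + ep] := spS t t2 tS t2S.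
  move=> pp; move: t2t' ne; rewrite ep; case/shortenP: pp => q pq uq _ t2t' ne.
  have qS : {subset q <= S}.
    by elim: q t {ep tS tt' t2t' ne uq} pq => //= z q IH t /andP[/and3P[_ _ zS] /IH h] w;
      rewrite inE => /predU1P[->//|/h].
  have /Tac /= : ucycle T [:: t', t & q].
    apply/andP; split=> /=.
      rewrite Tsym tt' rcons_path t2t' andbT.
      by apply: sub_path pq => u v /andP[].
    rewrite -[(t \notin q) && _]/(uniq (t :: q)) uq andbT inE negb_or.
    apply/andP; split; first by apply: contraNneq t'S => ->.
    by apply: contra t'S => /qS.
  by case: q {pq uq qS t2t'} ne => //=; rewrite eqxx.
have subS u v : u \in S -> v \in S ->
    connect [rel x y | [&& T x y, x \in t' |: S & y \in t' |: S]] u v.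
  move=> uS vS; apply: connect_sub (spS u v uS vS) => a b /and3P[ab aS bS].
  by apply: connect1; rewrite /= ab !inE aS bS !orbT.
have tt'1 : connect [rel x y | [&& T x y, x \in t' |: S & y \in t' |: S]] t t'.
  by apply: connect1; rewrite /= tt' !inE tS eqxx orbT.
have t't1 : connect [rel x y | [&& T x y, x \in t' |: S & y \in t' |: S]] t' t.
  by apply: connect1; rewrite /= Tsym tt' !inE tS eqxx orbT.
move=> u v; rewrite !inE => /predU1P[->|uS] /predU1P[->|vS].
- exact: connect0.
- exact: connect_trans t't1 (subS _ _ tS vS).
- exact: connect_trans (subS _ _ uS tS) tt'1.
- exact: subS.
Qed.

(** Counting the edges inside [S] along with its vertices gives [#|S| <= #|edges T|] before each
    step, which keeps the numerical bounds in terms of the number of edges. *)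
Lemma tree_ind (P : {set U} -> Prop) t0 t1 :
  T t0 t1 -> P [set t0; t1] ->
  (forall (S : {set U}) t t', t \in S -> t' \notin S -> T t t' ->
    (forall t2, t2 \in S -> T t2 t' -> t2 = t) -> 1 < #|S| <= #|edges T| ->
    P S -> P (t' |: S)) ->
  P setT.
Proof.
have [Tsym Tirr] := T_simple.
move=> t01 P0 PS.
pose inv S := [/\ connected_in S, 1 < #|S|, #|S| <= #|inner_edges S|.+1 & P S].
suff H n S : #|~: S| = n -> inv S -> P setT.
  apply: (H _ [set t0; t1] erefl).
  have ne : t0 != t1 by apply: contraTneq t01 => ->; rewrite Tirr.
  split=> // [x y||].
    have c01 : connect [rel x y | [&& T x y, x \in [set t0; t1] & y \in [set t0; t1]]] t0 t1.
      by apply: connect1; rewrite /= t01 !inE !eqxx orbT.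
    have c10 : connect [rel x y | [&& T x y, x \in [set t0; t1] & y \in [set t0; t1]]] t1 t0.
      by apply: connect1; rewrite /= Tsym t01 !inE !eqxx orbT.
    by rewrite !inE => /orP[]/eqP-> /orP[]/eqP-> //; exact: connect0.
    by rewrite cards2 ne.
  by rewrite cards2 ne ltnS card_gt0; apply/set0Pn; exists [set t0; t1]; rewrite inE edgesP /=.
elim: n S => [|n IH] S en [spS S1 Se Sp].
  by rewrite -(setCK S) (cards0_eq en) setC0 in Sp.
have S0 : S != set0 by rewrite -card_gt0; lia.
have ST : S != setT by apply/eqP => e; rewrite e setCT cards0 in en.
have [t [t' [tS t'S tt' uniq_t spS']]] := tree_grow spS S0 ST.
have lt : #|inner_edges S| < #|inner_edges (t' |: S)|.
  apply: proper_card; apply/properP; split.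
    apply/subsetP => j; rewrite !inE => /andP[-> jS] /=.
    exact: subset_trans jS (subsetUr _ _).
  exists [set t; t']; rewrite inE edgesP //= ?subUset ?sub1set.
    by rewrite !in_setU1 tS eqxx orbT.
  by rewrite (negbTE t'S) andbF.
have le : #|inner_edges (t' |: S)| <= #|edges T|.
  by apply: subset_leq_card; apply/subsetP => j; rewrite inE => /andP[].
apply: (IH (t' |: S)).
  have := cardsC S; have := cardsC (t' |: S); rewrite cardsU1 t'S; lia.
split=> //; rewrite ?cardsU1 ?t'S; try lia.
by apply: (PS S t t') => //; rewrite S1; lia.
Qed.
End TreeGrowth.

(** * Adding a leaf *)

Lemma leq_card_witness (X Y : finType) (A : {set X}) (B : {set Y}) (r : X -> Y -> bool) :
  (forall x, x \in A -> exists y, y \in B /\ r x y) ->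
  (forall x x' y, x \in A -> x' \in A -> r x y -> r x' y -> x = x') ->
  #|A| <= #|B|.
Proof.
move=> ex inj; pose g x := [pick y in B | r x y].
have gP x : x \in A -> exists y, [/\ g x = Some y, y \in B & r x y].
  move=> xA; rewrite /g; case: pickP => [y /andP[yB xy]|no]; first by exists y.
  by have [y [yB xy]] := ex x xA; have := no y; rewrite /= yB xy.
have g_inj : {in A &, injective g}.
  move=> x x' xA x'A; have [y [-> _ xy]] := gP x xA; have [y' [-> _ xy']] := gP x' x'A.
  by move=> [e]; apply: (inj _ _ y) => //; rewrite e.
rewrite -(card_in_imset g_inj) -(card_imset B Some_inj).
apply: subset_leq_card; apply/subsetP => _ /imsetP[x xA ->].
by have [y [-> yB _]] := gP x xA; apply: imset_f.
Qed.

Section Extension.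
Variables (U V Q I : finType) (base : Q -> V) (T : rel U) (R : U -> U -> rel Q) (D : nat).
Implicit Types (F : I -> U -> Q) (S : {set U}).

Hypothesis R_sym : forall t t' p q, R t t' p q = R t' t q p.
Hypothesis R_simple : forall t t' p q p' q', R t t' p q -> R t t' p' q' ->
  base p = base p' -> base q = base q' -> p = p' /\ q = q'.
Hypothesis R_irr : forall t t' p q, R t t' p q -> base p != base q.
Hypothesis T_sym : symmetric T.
Hypothesis T_irr : irreflexive T.
Hypothesis T_nbr : forall t, exists t', T t t'.
Hypothesis R_deg : forall t t' t'' p, T t t' -> T t t'' ->
  #|[set q | R t t' p q]| = #|[set q | R t t'' p q]|.
Hypothesis R_size : forall t t' p, T t t' ->
  #|[set q | R t t' p q]| = 0 \/ D <= #|[set q | R t t' p q]| <= D.*2.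

(* F i is a copy of the subtree of T on S, every arc of R belongs to exactly one
   copy, and s bounds the number of copies through a given p that also use a
   vertex lying over a given x. *)
Definition packing F S s :=
  [/\ forall t t', t \in S -> t' \in S -> T t t' ->
        [/\ forall i, R t t' (F i t) (F i t'),
            forall p q, R t t' p q -> exists i, F i t = p /\ F i t' = q &
            forall i i', F i t = F i' t -> F i t' = F i' t' -> i = i'],
      forall t t' p, t \in S -> T t t' ->
        #|[set i | F i t == p]| = #|[set q | R t t' p q]|,
      forall i, {in S &, injective (fun t => base (F i t))} &
      forall t t2 p x, t \in S -> t2 \in S -> t2 != t ->
        #|[set i | (F i t == p) && (base (F i t2) == x)]| <= s].

(** At a block [p], copies are matched to arcs. A copy rules out at most [#|S|] arcs, those ending
    over one of its vertices; an arc is ruled out by at most [s] copies for each [t2] other than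
    [t], by the last clause of [packing]. *)
Lemma matchings F S s K t t' :
  packing F S s -> t \in S -> T t t' -> 0 < s -> (#|S| * s + K).*2 <= D ->
  exists f : Q -> 'I_K -> I -> Q,
    [/\ forall k i, R t t' (F i t) (f (F i t) k i),
        forall k i t2, t2 \in S -> base (F i t2) != base (f (F i t) k i),
        forall k i i', F i t = F i' t ->
          f (F i t) k i = f (F i' t) k i' -> i = i' &
        forall k l i, f (F i t) k i = f (F i t) l i -> k = l].
Proof.
move=> [_ cardF injF confF] tS tt' s_gt0 hK.
pose ok i q := [forall t2 in S, base (F i t2) != base q].
suff /fin_all_exists[f Hf] : forall p, exists f : 'I_K -> I -> Q,
    [/\ forall k i, i \in [set i | F i t == p] ->
          f k i \in [set q | R t t' p q] /\ ok i (f k i),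
        forall k, {in [set i | F i t == p] &, injective (f k)} &
        forall i, i \in [set i | F i t == p] -> injective (f^~ i)].
  have mem i : i \in [set i0 | F i0 t == F i t] by rewrite inE.
  exists f; split=> [k i|k i|k i i' e|k l i].
  - by have [/(_ k i (mem i))[]] := Hf (F i t); rewrite inE.
  - by have [/(_ k i (mem i))[_ /forall_inP]] := Hf (F i t).
  - by have [_ + _] := Hf (F i t) => /(_ k); rewrite -e; apply; rewrite inE ?e.
  - by have [_ _ /(_ i (mem i))] := Hf (F i t); apply.
move=> p; apply: (@disjoint_bijections _ _ _ _ ok (#|S| * s)) => //.
- exact: cardF.
- move=> i; rewrite inE => /eqP ip.
  apply: (@leq_trans #|S|); last by rewrite leq_pmulr.
  apply: leq_trans (leq_imset_card (fun t2 => base (F i t2)) S).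
  rewrite -(@card_in_imset _ _ base) => [|q q']; last first.
    rewrite !inE => /andP[pq _] /andP[pq' _] e.
    by have [] := R_simple pq pq' erefl e.
  apply: subset_leq_card; apply/subsetP => _ /imsetP[q + ->].
  rewrite !inE => /andP[_ /forall_inPn[t2 t2S]]; rewrite negbK => /eqP <-.
  exact: imset_f.
- move=> q; rewrite inE => pq.
  apply: (@leq_trans #|\bigcup_(t2 in S :\ t)
      [set i | (F i t == p) && (base (F i t2) == base q)]|).
    apply: subset_leq_card; apply/subsetP => i; rewrite !inE.
    case/andP => ip /forall_inPn[t2 t2S]; rewrite negbK => e.
    apply/bigcupP; exists t2; last by rewrite inE ip.
    rewrite !inE t2S andbT; apply: contraTneq e => ->.
    by rewrite (eqP ip) (R_irr pq).
  apply: (@leq_trans (\sum_(t2 in S :\ t)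
      #|[set i | (F i t == p) && (base (F i t2) == base q)]|)).
    elim/big_rec2: _ => [|t2 m1 m2 _ le]; first by rewrite cards0.
    by apply: leq_trans (leq_card_setU _ _) _; rewrite leq_add2l.
  apply: (@leq_trans (\sum_(t2 in S :\ t) s)).
    by apply: leq_sum => t2; rewrite !inE => /andP[ne t2S]; apply: confF.
  by rewrite sum_nat_const leq_mul2r subset_leq_card ?orbT // subsetDl.
- rewrite (cardF _ _ _ tS tt'); case: (R_size p tt') => [->|/andP[le _]]; first by left.
  by right; apply: leq_trans le.
Qed.

(** Any pick of matchings yields the first three clauses of [packing]; [sparse_choice] secures the
    last one, the conflict bound. *)
Lemma packing_extend F S s K s' t t' :
  packing F S s -> t \in S -> t' \notin S -> T t t' ->
  (forall t2, t2 \in S -> T t2 t' -> t2 = t) ->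
  0 < s <= s' -> 0 < K -> (#|S| * s + K).*2 <= D ->
  8 * #|S| * D ^ 2 * 'C(D.*2 * s, s') * 2 ^ s' <= K ^ s' ->
  exists F', packing F' (t' |: S) s'.
Proof.
move=> pF tS t'S tt' uniq_t /andP[s_gt0 ss'] K_gt0 hK small.
have [f [fR fok f_inj f_disj]] := matchings pF tS tt' s_gt0 hK.
have [arcF cardF injF confF] := pF.
have size_W p : #|[set q | R t t' p q]| <= D.*2.
  by case: (R_size p tt') => [->|/andP[]].
have size_W' q : #|[set p | R t t' p q]| <= D.*2.
  rewrite (eq_card (B := [set p | R t' t q p])) => [|p]; last by rewrite !inE R_sym.
  by case: (@R_size t' t q) => [|->|/andP[]]; rewrite // T_sym.
have size_I p : #|[set i | F i t == p]| <= D.*2 by rewrite (cardF _ _ _ tS tt').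
have size_I2 t2 q : t2 \in S -> #|[set i | F i t2 == q]| <= D.*2.
  move=> t2S; have [t3 t23] := T_nbr t2; rewrite (cardF _ _ _ t2S t23).
  by case: (R_size q t23) => [->|/andP[]].
have fW p k i : F i t = p -> R t t' p (f p k i) by move=> <-.
(* hit (b, t2, q, x) i y: if i is extended by y at the new vertex t', then it
   counts towards the copies with t2 at q and t' over x (b = true), or with
   t' at q and t2 over x (b = false). For fixed key these copies sit at distinct
   values of F i t, so their extensions are chosen independently. *)
pose hit (k : bool * U * Q * V) i y := let: (b, t2, q, x) := k in
  (t2 \in S :\ t) && if b then (F i t2 == q) && (base y == x)
                     else (base (F i t2) == x) && (y == q).
pose Z k := [set pa : Q * 'I_K | [exists i, (F i t == pa.1) && hit k i (f pa.1 pa.2 i)]].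
have [|||c hc] := @sparse_choice Q (bool * U * Q * V)%type K s'
    (8 * #|S| * D ^ 2) (D.*2 * s) Z _ _ small K_gt0 _; last first.
- pose g i := f (F i t) (c (F i t)) i.
  pose F' i u := if u == t' then g i else F i u.
  have F'S i u : u \in S -> F' i u = F i u.
    by move=> uS; rewrite /F' ifN //; apply: contraNneq t'S => <-.
  have F't' i : F' i t' = g i by rewrite /F' eqxx.
  have gR i : R t t' (F i t) (g i) by apply: fR.
  have g_inj i i' : F i t = F i' t -> g i = g i' -> i = i'.
    by move=> e; rewrite /g e => e'; apply: (f_inj (c (F i' t))) => //; rewrite e.
  have g_surj p q : R t t' p q -> exists i, F i t = p /\ g i = q.
    move=> pq; have : q \in g @: [set i | F i t == p].
      rewrite (_ : g @: _ = [set q | R t t' p q]) ?inE //.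
      apply/eqP; rewrite eqEcard; apply/andP; split.
        by apply/subsetP => _ /imsetP[i + ->]; rewrite !inE => /eqP <-.
      rewrite -(cardF _ _ _ tS tt') card_in_imset // => i i'.
      by rewrite !inE => /eqP ip /eqP ip'; apply: g_inj; rewrite ip.
    by case/imsetP => i; rewrite inE => /eqP ip ->; exists i.
  (* Two copies in [A] with the same [F i t] coincide, one matching being injective there; so [A] is
     no larger than the set of unlucky blocks. *)
  have conflict b t2 q x (A : {set I}) : t2 \in S :\ t ->
      (forall i, i \in A -> hit (b, t2, q, x) i (g i)) ->
      #|A| <= s'.
    move=> t2S hA; apply: leq_trans (ltnW (hc (b, t2, q, x))).
    apply: (leq_card_witness (r := fun i p => F i t == p)) => [i iA|i i' p iA i'A].
      exists (F i t); rewrite eqxx inE; split=> //; rewrite inE.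
      by apply/existsP; exists i; rewrite eqxx; apply: hA.
    move=> /eqP ip /eqP ip'; have := hA _ iA; have := hA _ i'A; rewrite /hit t2S /=.
    have e : F i t = F i' t by rewrite ip.
    case: {hA} b => /andP[/eqP h1 /eqP h2] /andP[/eqP h3 /eqP h4].
      apply: (g_inj _ _ e).
      by have [] := R_simple (gR i) (gR i') (congr1 base e); rewrite ?h2 ?h4.
    by apply: (g_inj _ _ e); rewrite h2 h4.
  exists F'; split.
  + have arcs_tt' : [/\ forall i, R t t' (F' i t) (F' i t'),
            forall p q, R t t' p q -> exists i, F' i t = p /\ F' i t' = q &
            forall i i', F' i t = F' i' t -> F' i t' = F' i' t' -> i = i'].
      split=> [i|p q|i i']; [by rewrite F't' F'S | | by rewrite !F't' !F'S //; apply: g_inj].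
      by case/g_surj => i [ip iq]; exists i; rewrite F't' F'S.
    move=> u u' /setU1P[->|uS] /setU1P[->|u'S]; rewrite ?T_irr //.
    * move=> e; have -> : u' = t by apply: uniq_t; rewrite // T_sym.
      have [h1 h2 h3] := arcs_tt'; split=> [i|p q|i i' e1 e2]; first by rewrite R_sym.
        by rewrite R_sym => /h2[i [e1 e2]]; exists i.
      exact: h3.
    * by move=> e; rewrite (uniq_t u uS e).
    * move=> e; have [h1 h2 h3] := arcF u u' uS u'S e.
      split=> [i|p q /h2[i [e1 e2]]|i i']; rewrite ?F'S //; last exact: h3.
      by exists i; rewrite !F'S.
  + move=> u u' p /setU1P[-> e|uS e]; last first.
      by rewrite -(cardF _ _ _ uS e); apply: eq_card => i; rewrite !inE F'S.
    have t't : T t' t by rewrite T_sym.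
    rewrite (R_deg p e t't) (eq_card (B := [set q | R t t' q p])); last first.
      by move=> q; rewrite !inE R_sym.
    have g_injp : {in [set i | g i == p] &, injective (fun i => F i t)}.
      by move=> i i'; rewrite !inE => /eqP ip /eqP ip' ei; apply: g_inj; rewrite ?ip.
    rewrite (eq_card (B := [set i | g i == p])); last by move=> i; rewrite !inE F't'.
    rewrite -(card_in_imset g_injp); apply: eq_card => q; rewrite inE.
    apply/imsetP/idP => [[i + ->]|/g_surj[i [iq ip]]]; first by rewrite inE => /eqP <-.
    by exists i; rewrite ?inE ?ip.
  + have key i u : u \in S -> base (F i u) = base (g i) -> u = t'.
      by move=> uS e; have := fok (c (F i t)) i u uS; rewrite -/(g i) e eqxx.
    move=> i u u' /setU1P[->|uS] /setU1P[->|u'S]; rewrite ?F't' ?F'S //.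
    * by move=> e; rewrite (key i u').
    * exact: key.
    * exact: injF.
  (* When the other vertex is [t], a block and a base vertex determine the arc, hence the copy,
     whatever the picks. *)
  + have small1 (A : {set I}) : (forall i i', i \in A -> i' \in A -> i = i') -> #|A| <= s'.
      move=> A1; apply: (@leq_trans 1); last by lia.
      by apply/card_le1P => i iA i'; rewrite inE; apply/idP/eqP => [/(A1 _ _ iA)|->].
    move=> u u2 p x /setU1P[->|uS] /setU1P[->|u2S] ne; rewrite ?eqxx // in ne.
    * have [e|ne2] := eqVneq u2 t.
        apply: small1 => i i'; rewrite !inE e !F't' !F'S //.
        move=> /andP[/eqP h1 /eqP h2] /andP[/eqP h3 /eqP h4].
        have [] := R_simple (gR i) (gR i'); rewrite ?h2 ?h4 ?h1 ?h3 // => h _.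
        by apply: g_inj; rewrite // h1 h3.
      apply: (@conflict false u2 p x); first by rewrite !inE ne2.
      by move=> i; rewrite /hit in_setD1 ne2 u2S inE F't' F'S //= andbC.
    * have [e|ne2] := eqVneq u t.
        apply: small1 => i i'; rewrite !inE e !F't' !F'S //.
        move=> /andP[/eqP h1 /eqP h2] /andP[/eqP h3 /eqP h4].
        have [] := R_simple (gR i) (gR i'); rewrite ?h2 ?h4 ?h1 ?h3 // => _ h.
        by apply: g_inj; rewrite // h1 h3.
      apply: (@conflict true u p x); first by rewrite !inE ne2.
      by move=> i; rewrite /hit in_setD1 ne2 uS inE F't' F'S.
    * apply: leq_trans ss'; apply: leq_trans (confF u u2 p x uS u2S ne).
      by apply: subset_leq_card; apply/subsetP => i; rewrite !inE !F'S.
- by apply: leq_trans s_gt0 ss'.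
- move=> p.
  (* A key that [p] can affect is determined by [b], [t2], one of at most [2D] copies at [p] and one
     of at most [2D] arcs. *)
  pose h (w : bool * U * I * Q) := let: (b, t2, i, q) := w in
    if b then (b, t2, F i t2, base q) else (b, t2, q, base (F i t2)).
  apply: (@leq_trans #|h @: setX (setX (setX [set: bool] S) [set i | F i t == p])
      [set q | R t t' p q]|).
    apply: subset_leq_card; apply/subsetP => -[[[b t2] q] x].
    rewrite inE => /existsP[a]; rewrite inE => /existsP[i /= /andP[ip]].
    case/andP => t2S hb; apply/imsetP; exists (b, t2, i, f p a i).
      by move: t2S; rewrite !inE ip fW ?(eqP ip) //= => /andP[_ ->].
    by move: hb => /=; case: (b) => /andP[/eqP -> /eqP ->].
  apply: leq_trans (leq_imset_card _ _) _; rewrite !cardsX cardsT card_bool.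
  have := leq_mul (size_I p) (size_W p); nia.
- case=> [[[b t2] q] x]; rewrite /Z /hit; case: (boolP (t2 \in S :\ t)) => t2S; last first.
    rewrite (_ : [set _ | _] = set0) ?cards0 //; apply/setP => pa; rewrite !inE.
    by apply/negbTE/negP => /existsP[i]; rewrite andbF.
  have [t2t t2S'] : t2 != t /\ t2 \in S by apply/andP; rewrite in_setD1 in t2S.
  (* For [b] true at most [2D] copies have [t2] at [q]; for [b] false at most [2D] blocks are joined
     to [q], with [s] copies each. The copy fixes the block, and disjointness fixes the index of the
     matching. *)
  case: b => /=.
    apply: (@leq_trans #|[set i | F i t2 == q]|); last first.
      by apply: leq_trans (size_I2 _ _ t2S') _; rewrite leq_pmulr.
    apply: (leq_card_witness
      (r := fun pa i => (F i t == pa.1) && (base (f pa.1 pa.2 i) == x))).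
      case=> p a; rewrite inE => /existsP[i /and3P[ip iq ix]].
      by exists i; rewrite inE iq ip ix.
    move=> [p a] [p' a'] i _ _ /= /andP[/eqP <- /eqP h1] /andP[/eqP <- /eqP h2].
    congr (_, _); apply: (@f_disj _ _ i).
    by have [] := R_simple (fR a i) (fR a' i) erefl; rewrite ?h1 ?h2.
  apply: (@leq_trans #|[set i | (base (F i t2) == x) && R t t' (F i t) q]|).
    apply: (leq_card_witness (r := fun pa i => (F i t == pa.1) && (f pa.1 pa.2 i == q))).
      case=> p a; rewrite inE => /existsP[i /and3P[/= /eqP ip ix /eqP iq]].
      by exists i; rewrite inE ix ip iq !eqxx -iq fW.
    move=> [p a] [p' a'] i _ _ /= /andP[/eqP <- /eqP h1] /andP[/eqP <- /eqP h2].
    by congr (_, _); apply: (@f_disj _ _ i); rewrite h1 h2.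
  apply: (@leq_trans #|\bigcup_(p in [set p | R t t' p q])
      [set i | (F i t == p) && (base (F i t2) == x)]|).
    apply: subset_leq_card; apply/subsetP => i; rewrite inE => /andP[ix iq].
    by apply/bigcupP; exists (F i t); rewrite inE ?eqxx.
  apply: (@leq_trans (\sum_(p in [set p | R t t' p q]) s)).
    apply: (@leq_trans (\sum_(p in [set p | R t t' p q])
        #|[set i | (F i t == p) && (base (F i t2) == x)]|)).
      elim/big_rec2: _ => [|p m1 m2 _ le]; first by rewrite cards0.
      by apply: leq_trans (leq_card_setU _ _) _; rewrite leq_add2l.
    by apply: leq_sum => p _; apply: confF.
  by rewrite sum_nat_const leq_mul2r size_W' orbT.
Qed.
End Extension.

(** * Packing copies of the whole tree *)

Section Packing.
Variables (U V : finType) (T : rel U) (R0 : U -> U -> rel V).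
Hypotheses (T_simple : simple_graph T) (T_tree : is_tree T).
Variables (m D : nat).
Hypotheses (card_T : #|edges T| = m) (D_def : D = 10 ^ (50 * m)) (m_gt0 : 0 < m).
Hypothesis R0_sym : forall t t' v w, R0 t t' v w = R0 t' t w v.
Hypothesis R0_irr : forall t t' v, ~~ R0 t t' v v.
Hypothesis R0_deg : forall t t' t'' v, T t t' -> T t t'' ->
  #|[set w | R0 t t' v w]| = #|[set w | R0 t t'' v w]|.
Hypothesis R0_large : forall t t' v, T t t' ->
  #|[set w | R0 t t' v w]| = 0 \/ D <= #|[set w | R0 t t' v w]|.

(* The arcs at v playing the role of t are cut into blocks of size between D and
   2D; (v, r) is the r-th block. The block sizes depend only on the degree, so they
   are the same for all neighbours t' of t. *)
Lemma split_arcs : exists R : U -> U -> rel (V * 'I_#|V|.+1),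
  [/\ forall t t' p q, R t t' p q = R t' t q p,
      forall t t' p q, R t t' p q -> R0 t t' p.1 q.1,
      forall t t' p q p' q', R t t' p q -> R t t' p' q' ->
        p.1 = p'.1 -> q.1 = q'.1 -> p = p' /\ q = q',
      forall t t' v w, R0 t t' v w -> exists p q, [/\ R t t' p q, p.1 = v & q.1 = w] &
      (forall t t' t'' p, T t t' -> T t t'' ->
         #|[set q | R t t' p q]| = #|[set q | R t t'' p q]|) /\
      (forall t t' p, T t t' ->
         #|[set q | R t t' p q]| = 0 \/ D <= #|[set q | R t t' p q]| <= D.*2)].
Proof.
have D_gt0 : 0 < D by rewrite D_def expn_gt0.
have /fin_all_exists[H HP] : forall d : 'I_#|V|.+1, exists h : nat -> nat,
    nat_of_ord d = 0 \/ D <= d -> (forall a, a < d -> h a < d) /\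
      forall r, count (fun a => h a == r) (iota 0 d) = 0 \/
        D <= count (fun a => h a == r) (iota 0 d) <= D.*2.
  move=> d; case: (leqP D d) => [le|lt]; first by have [h hP] := blocks D_gt0 le; exists h.
  (* Below [D] the premise leaves only [d = 0], where any function will do. *)
  by exists id => -[->|]; [split=> // r; left | lia].
pose N t t' v := [set w | R0 t t' v w].
pose h n := H (inord n).
pose lab t t' v w : 'I_#|V|.+1 := inord (h #|N t t' v| (index w (enum (N t t' v)))).
pose R t t' (p q : V * 'I_#|V|.+1) :=
  [&& R0 t t' p.1 q.1, p.2 == lab t t' p.1 q.1 & q.2 == lab t' t q.1 p.1].
have card_R t t' p : T t t' ->
    #|[set q | R t t' p q]| = count (fun a => h #|N t t' p.1| a == p.2) (iota 0 #|N t t' p.1|).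
  move=> tt'; have [hlt _] : let n := #|N t t' p.1| in (forall a, a < n -> h n a < n) /\ True.
    have := HP (inord #|N t t' p.1|); rewrite inordK ?ltnS ?max_card // => hp.
    by have [] := hp (R0_large p.1 tt').
  rewrite -card_block -(@card_in_imset _ _ fst) => [|q q']; last first.
    rewrite !inE => /and3P[_ _ /eqP e] /and3P[_ _ /eqP e'].
    by case: q e => q1 q2 /= ->; case: q' e' => q1' q2' /= -> ->.
  apply: eq_card => w; rewrite !inE.
  apply/imsetP/andP => [[q + ->]|[pw /eqP e]].
    rewrite inE => /and3P[pq /eqP e _]; split=> //.
    have qN : q.1 \in N t t' p.1 by rewrite inE.
    rewrite e inordK //; apply: (@leq_trans #|N t t' p.1|.+1); last by rewrite ltnS max_card.
    by apply/leqW/hlt; rewrite [X in _ < X]cardE index_mem mem_enum.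
  exists (w, lab t' t w p.1) => //; rewrite inE /R /= pw eqxx andbT.
  by rewrite -val_eqE /= /lab e inord_val.
exists R; split.
- by move=> t t' p q; rewrite /R R0_sym; congr (_ && _); rewrite andbC.
- by move=> t t' p q /and3P[].
- move=> t t' [p1 p2] [q1 q2] [p1' p2'] [q1' q2'] /and3P[/= _ /eqP-> /eqP->].
  by move=> /and3P[/= _ /eqP-> /eqP->] -> ->.
- move=> t t' v w vw; exists (v, lab t t' v w), (w, lab t' t w v).
  by rewrite /R /= vw !eqxx.
- split=> [t t' t'' p tt' tt''|t t' p tt'].
    by rewrite !card_R // (R0_deg p.1 tt' tt'').
  rewrite card_R //; have := HP (inord #|N t t' p.1|).
  rewrite inordK ?ltnS ?max_card // => hp.
  by have [_] := hp (R0_large p.1 tt'); apply.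
Qed.

(** The index type is fixed from the start: one copy for every arc over a first edge [t0 t1]. Adding
    leaves neither creates nor removes copies. *)
Lemma tree_packing : exists (I : finType) (F : I -> U -> V),
  (forall i, injective (F i)) /\
  forall t t', T t t' ->
    [/\ forall i, R0 t t' (F i t) (F i t'),
        forall v w, R0 t t' v w -> exists i, F i t = v /\ F i t' = w &
        forall i i', F i t = F i' t -> F i t' = F i' t' -> i = i'].
Proof.
have [Tsym Tirr] := T_simple; have [_ Tconn _] := T_tree.
have [R [R_sym R_R0 R_simple R_ex [R_deg R_size]]] := split_arcs.
have R_irr t t' p q : R t t' p q -> p.1 != q.1.
  by move=> /R_R0; apply: contraTneq => ->; apply: R0_irr.
have [t0 [t1 t01]] : exists t0 t1, T t0 t1.
  have /card_gt0P[j] : 0 < #|edges T| by rewrite card_T.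
  rewrite inE => /existsP[t0 /existsP[t1 /andP[h _]]].
  by exists t0, t1.
have ne01 : t0 != t1 by apply: contraTneq t01 => ->; rewrite Tirr.
have T_nbr t : exists t', T t t'.
  have [->|ne] := eqVneq t t0; first by exists t1.
  have /connectP[[|t' p] /=] := Tconn t t0; first by move=> _ e; rewrite e eqxx in ne.
  by case/andP => tt' _ _; exists t'.
(* 100 divides [D], since [50 * m] is at least 2. *)
have [K eK] : exists K, D = 4 * K.
  exists (25 * 10 ^ (50 * m - 2)); rewrite D_def mulnA -[4 * 25]/(10 ^ 2) -expnD.
  by congr (10 ^ _); lia.
have K_gt0 : 0 < K by rewrite -(@ltn_pmul2l 4) // -eK D_def expn_gt0.
pose Q := (V * 'I_#|V|.+1)%type.
pose I : finType := {x : Q * Q | R t0 t1 x.1 x.2}.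
pose P S := exists F : I -> U -> Q, packing fst T R F S (4 * m * 128 ^ #|S|).
suff [F [arcsF _ injF _]] : P setT.
  exists I, (fun i t => (F i t).1); split=> [i t t'|t t' tt'].
    by move=> e; apply: (injF i); rewrite ?inE.
  have [h1 h2 h3] := arcsF t t' (in_setT _) (in_setT _) tt'; split=> [i|v w|i i' e e'].
  - exact/R_R0/h1.
  - case/R_ex => p [q [pq <- <-]]; have [i [<- <-]] := h2 p q pq; by exists i.
  - by have [] := R_simple _ _ _ _ _ _ (h1 i) (h1 i') e e'; apply: h3.
apply: (tree_ind T_simple T_tree t01) => [|S t t' tS t'S tt' uniq_t /andP[S1 Sm] [F pF]].
  (* Off [t0] and [t1] the value is arbitrary. *)
  pose F (i : I) u := if u == t0 then (val i).1 else (val i).2.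
  have F0 i : F i t0 = (val i).1 by rewrite /F eqxx.
  have F1 i : F i t1 = (val i).2 by rewrite /F eq_sym (negbTE ne01).
  have FR i : R t0 t1 (F i t0) (F i t1) by rewrite F0 F1; apply: (valP i).
  have Finj i i' : F i t0 = F i' t0 -> F i t1 = F i' t1 -> i = i'.
    rewrite !F0 !F1 => e e'; apply: val_inj.
    by case: (val i) (val i') e e' => p q [p' q'] /= -> ->.
  have Fex p q : R t0 t1 p q -> exists i, F i t0 = p /\ F i t1 = q.
    by move=> pq; exists (exist _ (p, q) pq); rewrite F0 F1.
  have FR' i : R t1 t0 (F i t1) (F i t0) by rewrite R_sym.
  exists F; split.
  - move=> t t'; rewrite !inE => /orP[]/eqP-> /orP[]/eqP->; rewrite ?Tirr // => _.
    split=> // [p q|i i' e e']; last exact: Finj.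
    by rewrite R_sym => /Fex[i [ip iq]]; exists i.
  - move=> t t' p; rewrite !inE => /orP[]/eqP-> tt'.
      rewrite (R_deg _ _ _ p tt' t01) -(@card_in_imset _ _ (F^~ t1)) => [|i i']; last first.
        by rewrite !inE => /eqP ip /eqP ip' e; apply: Finj; rewrite ?ip.
      apply: eq_card => q; rewrite inE; apply/imsetP/idP => [[i + ->]|/Fex[i [ip iq]]].
        by rewrite inE => /eqP <-.
      by exists i; rewrite ?inE ?ip.
    have t10 : T t1 t0 by rewrite Tsym.
    rewrite (R_deg _ _ _ p tt' t10) -(@card_in_imset _ _ (F^~ t0)) => [|i i']; last first.
      by rewrite !inE => /eqP ip /eqP ip' e; apply: Finj; rewrite ?ip.
    apply: eq_card => q; rewrite inE; apply/imsetP/idP => [[i + ->]|].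
      by rewrite inE => /eqP <-.
    by rewrite R_sym => /Fex[i [ip iq]]; exists i; rewrite ?inE ?iq.
  - move=> i t t'; rewrite !inE => /orP[]/eqP-> /orP[]/eqP-> //.
      by move/eqP; rewrite (negbTE (R_irr _ _ _ _ (FR i))).
    by move/eqP; rewrite (negbTE (R_irr _ _ _ _ (FR' i))).
  (* A block at one end and a base vertex at the other fix the arc, so at most one copy counts. *)
  - move=> t t2 p x tS t2S ne; apply: (@leq_trans 1); last first.
      by rewrite muln_gt0 expn_gt0 !andbT muln_gt0.
    apply/card_le1P => i iA i'; rewrite inE; apply/idP/eqP => [i'A|->]; last by rewrite inE in iA.
    move: tS t2S ne iA i'A; rewrite !inE.
    move=> /orP[]/eqP-> /orP[]/eqP->; rewrite ?eqxx // => _.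
      move=> /andP[/eqP ip /eqP ix] /andP[/eqP ip' /eqP ix'].
      have e1 : (F i' t1).1 = (F i t1).1 by rewrite ix ix'.
      have e0 : F i' t0 = F i t0 by rewrite ip.
      by have [_] := R_simple _ _ _ _ _ _ (FR i') (FR i) (congr1 fst e0) e1; apply: Finj.
    move=> /andP[/eqP ip /eqP ix] /andP[/eqP ip' /eqP ix'].
    have e0 : (F i' t0).1 = (F i t0).1 by rewrite ix ix'.
    have e1 : F i' t1 = F i t1 by rewrite ip.
    by have [h _] := R_simple _ _ _ _ _ _ (FR i') (FR i) e0 (congr1 fst e1); apply: Finj.
rewrite card_T in Sm.
have eS : 4 * m * 128 ^ #|t' |: S| = 128 * (4 * m * 128 ^ #|S|).
  by rewrite cardsU1 t'S add1n expnS mulnCA.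
have ms : 4 * m <= 4 * m * 128 ^ #|S| by rewrite leq_pmulr // expn_gt0.
apply: (packing_extend R_sym R_simple R_irr Tsym Tirr T_nbr R_deg R_size pF tS t'S tt'
  uniq_t _ K_gt0).
- by rewrite eS; apply/andP; split; lia.
- by rewrite D_def; apply: room_for_matchings; rewrite // -D_def.
- exact: (few_forbidden m_gt0 Sm eK D_def ms).
Qed.
End Packing.

(** * Equitable colourings *)

Lemma set2_eq (X : finType) (a b c d : X) :
  [set a; b] = [set c; d] -> a = c /\ b = d \/ a = d /\ b = c.
Proof.
move=> e; have := set21 a b; have := set22 a b; rewrite e !inE.
have := set21 c d; have := set22 c d; rewrite -e !inE.
by do 4 case/orP => /eqP ?; subst; auto.
Qed.

Section Colouring.
Variables (U V : finType) (T : rel U) (G : rel V).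
Variables (TA TB : {set U}) (A B : {set V}) (phi : {set V} -> {set U}).
Hypotheses (T_simple : simple_graph T) (G_simple : simple_graph G).
Hypotheses (T_bip : bipartition T TA TB) (G_bip : bipartition G A B).
Hypothesis phi_col : edge_colouring G T phi.
Hypothesis phi_eq : T_equitable G T A B TA TB phi.

(** Compatibility orients a coloured edge: it tells which end plays [t] and which plays [t']. *)
Definition arc t t' v w :=
  [&& G v w, phi [set v; w] == [set t; t'],
      compatible A B TA TB v t & compatible A B TA TB w t'].

Lemma arc_sym t t' v w : arc t t' v w = arc t' t w v.
Proof.
have [Gsym _] := G_simple.
by rewrite /arc Gsym (setUC [set v]) (setUC [set t]); do 2 congr (_ && _); rewrite andbC.
Qed.

Lemma arc_irr t t' v : ~~ arc t t' v v.
Proof. by have [_ Girr] := G_simple; rewrite /arc Girr. Qed.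

Lemma compatible_edge t t' v w :
  T t t' -> G v w -> compatible A B TA TB v t -> compatible A B TA TB w t'.
Proof.
have [dT _ bT] := T_bip; have [dG _ bG] := G_bip; rewrite /compatible.
have nT x : x \in TA -> x \in TB -> False by move/(disjointFr dT) => ->.
have nG x : x \in A -> x \in B -> False by move/(disjointFr dG) => ->.
move=> /bT tt' /bG vw.
case/orP: tt' => /andP[h1 h2]; case/orP: vw => /andP[h3 h4];
  case/orP => /andP[h5 h6]; rewrite ?h2 ?h4 ?orbT //.
all: by [case: (nT t) | case: (nG v)].
Qed.

Lemma compatible_adj t t' v :
  T t t' -> compatible A B TA TB v t -> ~~ compatible A B TA TB v t'.
Proof.
have [dT _ bT] := T_bip; have [dG _ _] := G_bip.
have nT x : x \in TA -> x \in TB -> False by move/(disjointFr dT) => ->.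
have nG x : x \in A -> x \in B -> False by move/(disjointFr dG) => ->.
move=> /bT tt' c1; apply/negP => c2; move: c1 c2 tt'.
by case/orP => /andP[h1 h2]; case/orP => /andP[h3 h4]; case/orP => /andP[h5 h6];
  (try by case: (nG v)); (try by case: (nT t)); by case: (nT t').
Qed.

(** Compatibility at one end forces it at the other, so the arcs at [v] account for the whole colour
    degree or for nothing; this gives the dichotomy [R0_large]. *)
Lemma card_arc t t' v : T t t' ->
  #|[set w | arc t t' v w]| =
  if compatible A B TA TB v t then deg_col G phi [set t; t'] v else 0.
Proof.
have [Gsym Girr] := G_simple; move=> tt'; case: ifP => cv; last first.
  by apply/eqP; rewrite cards_eq0; apply/eqP/setP => w; rewrite !inE /arc cv !andbF.
rewrite /deg_col -(@card_in_imset _ _ (fun w => [set v; w])) => [|w w']; last first.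
  rewrite !inE => /and4P[vw _ _ _] /and4P[vw' _ _ _] e.
  have : w \in [set v; w'] by rewrite -e !inE eqxx orbT.
  by rewrite !inE => /orP[]/eqP // ew; rewrite ew Girr in vw.
apply: eq_card => j; rewrite inE.
apply/imsetP/andP => [[w + ->]|[je /andP[vj pj]]].
  by rewrite inE => /and4P[vw pvw _ _]; rewrite edgesP // !inE eqxx.
have [w vw ej] : exists2 w, G v w & j = [set v; w].
  move: je vj; rewrite inE => /existsP[x /existsP[y /andP[xy /eqP ->]]].
  rewrite !inE => /orP[]/eqP->; first by exists y.
  by exists x; [rewrite Gsym | rewrite setUC].
exists w => //; rewrite inE /arc vw -ej pj cv; exact: compatible_edge vw cv.
Qed.

Lemma edge_arc e : e \in edges G -> exists t t' v w,
  [/\ T t t', arc t t' v w & e = [set v; w]].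
Proof.
have [_ UT bT] := T_bip; have [_ UG bG] := G_bip; have [Tsym _] := T_simple.
move=> eG; have := phi_col eG; rewrite inE => /existsP[t /existsP[t' /andP[tt' /eqP ephi]]].
move: eG ephi; rewrite inE => /existsP[v /existsP[w /andP[vw /eqP ->]]] ephi.
have [cv|cv] : compatible A B TA TB v t \/ compatible A B TA TB v t'.
  rewrite /compatible; case/orP: (bG _ _ vw) => /andP[-> _];
    case/orP: (bT _ _ tt') => /andP[-> ->]; rewrite ?orbT; by [left | right].
- exists t, t', v, w; split=> //; rewrite /arc vw ephi eqxx cv.
  exact: compatible_edge vw cv.
- have t't : T t' t by rewrite Tsym.
  exists t', t, v, w; split=> //; rewrite /arc vw ephi setUC eqxx cv.
  exact: compatible_edge vw cv.
Qed.

Lemma arc_deg t t' t'' v : T t t' -> T t t'' ->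
  #|[set w | arc t t' v w]| = #|[set w | arc t t'' v w]|.
Proof.
move=> tt' tt''; rewrite !card_arc //; case: ifP => // cv.
by apply: (phi_eq cv); rewrite inE edgesP // !inE eqxx.
Qed.

(** An edge of [G] comes from one arc up to reversal, so two copies sharing an edge share an arc and
    coincide; the edge [t0 t1] makes the parts nonempty. *)
Lemma decomposition_of_packing (I : finType) (F : I -> U -> V) t0 t1 :
  T t0 t1 -> (forall i, injective (F i)) ->
  (forall t t', T t t' ->
    [/\ forall i, arc t t' (F i t) (F i t'),
        forall v w, arc t t' v w -> exists i, F i t = v /\ F i t' = w &
        forall i i', F i t = F i' t -> F i t' = F i' t' -> i = i']) ->
  exists D, T_decomposition G T D.
Proof.
move=> t01 Finj Farc; have [Tsym _] := T_simple.
pose copy i := [set [set F i x; F i y] | x in U, y in U & T x y].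
have copyP i e : reflect (exists x y, T x y /\ e = [set F i x; F i y]) (e \in copy i).
  apply: (iffP imset2P) => [[x y _ + ->]|[x [y [xy ->]]]].
    by rewrite inE => /andP[_ xy]; exists x, y.
  by exists x y => //; rewrite inE xy.
have arc_eq t t' v w x y v' w' : T t t' -> T x y -> arc t t' v w -> arc x y v' w' ->
    [set v; w] = [set v'; w'] ->
    [/\ t = x, t' = y, v = v' & w = w'] \/ [/\ t = y, t' = x, v = w' & w = v'].
  move=> tt' xy /and4P[vw /eqP p1 c1 c2] /and4P[vw' /eqP p2 c3 c4] e.
  have e2 : [set t; t'] = [set x; y] by rewrite -p1 e p2.
  (* In the two mixed cases a vertex would be compatible with both ends of an edge of [T]. *)
  have [[? ?]|[? ?]] := set2_eq e2; have [[? ?]|[? ?]] := set2_eq e; subst.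
  - by left.
  - by have := compatible_adj xy c1; rewrite c4.
  - by have := compatible_adj xy c3; rewrite c1.
  - by right.
have copy_inj i i' e : e \in copy i -> e \in copy i' -> i = i'.
  move=> /copyP[x [y [xy ->]]] /copyP[x' [y' [xy' ee]]].
  have [h1 h2 h3] := Farc _ _ xy; have [h1' _ _] := Farc _ _ xy'.
  by have [[? ? ex ey]|[? ? ex ey]] := arc_eq _ _ _ _ _ _ _ _ xy xy' (h1 i) (h1' i') ee;
    subst; apply: h3.
exists (copy @: [set: I]); split; last first.
  by move=> P /imsetP[i _ ->]; exists (F i).
apply/and3P; split.
- apply/eqP/setP => e; apply/bigcupP/idP => [[_ /imsetP[i _ ->] /copyP[x [y [xy ->]]]]|eG].
    by have [/(_ i)/and4P[h _ _ _] _ _] := Farc _ _ xy; apply: edgesP.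
  have [t [t' [v [w [tt' vw ->]]]]] := edge_arc eG.
  have [_ /(_ v w vw)[i [<- <-]] _] := Farc _ _ tt'.
  by exists (copy i); [apply: imset_f; rewrite inE | apply/copyP; exists t, t'].
- apply/trivIsetP => _ _ /imsetP[i _ ->] /imsetP[i' _ ->] ne.
  apply/pred0P => e; apply/negbTE/negP => /andP[ei ei'].
  by rewrite (copy_inj i i' e ei ei') eqxx in ne.
- apply/negP => /imsetP[i _ e0].
  have : [set F i t0; F i t1] \in copy i by apply/copyP; exists t0, t1.
  by rewrite -e0 inE.
Qed.

End Colouring.

Theorem theorem5 (U V : finType) (T : rel U) (G : rel V)
  (TA TB : {set U}) (A B : {set V}) (m : nat) (phi : {set V} -> {set U}) :
  simple_graph T -> is_tree T -> #|edges T| = m -> bipartition T TA TB ->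
  simple_graph G -> bipartition G A B ->
  edge_colouring G T phi -> T_equitable G T A B TA TB phi ->
  (forall v j, j \in edges T -> 10 ^ (50 * m) <= deg_col G phi j v) ->
  exists D : {set {set {set V}}}, T_decomposition G T D.
Proof.
move=> Ts Tt em Tb Gs Gb col eqt; move eD : (10 ^ (50 * m)) => D large.
(* Without colours [G] has no edges, and the empty partition works. *)
have [m0|m_gt0] := posnP m.
  rewrite m0 in em; exists set0; split=> [|P]; last by rewrite inE.
  have -> : edges G = set0.
    by apply/setP => e; rewrite [RHS]inE; apply/negP => /col; rewrite (cards0_eq em) inE.
  by rewrite /partition /cover big_set0 eqxx /trivIset /cover !big_set0 cards0 inE.
have [t0 [t1 t01]] : exists t0 t1, T t0 t1.
  have /card_gt0P[j] : 0 < #|edges T| by rewrite em.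
  by rewrite inE => /existsP[t0 /existsP[t1 /andP[h _]]]; exists t0, t1.
have [|I [F [Finj Farc]]] := tree_packing Ts Tt em (esym eD) m_gt0 (arc_sym TA TB A B phi Gs)
  (arc_irr TA TB A B phi Gs) (arc_deg Gs Tb Gb eqt).
  move=> t t' v tt'; rewrite (card_arc phi Gs Tb Gb v tt'); case: ifP => _; [right|by left].
  exact/large/edgesP.
exact: decomposition_of_packing t01 Finj Farc.
Qed.
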